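(* If $n\geq 13$, then $t(K(n,4))=\frac{n}{4}-1$. Moreover, if $S$ is a vertex cut of $K(n,4)$ such that $\frac{|S|}{c(K(n,4)\setminus S)} = \frac{n}{4}-1$, then $S$ is the complement of a maximum independent set of $K(n,4)$.
   Context: The Kneser graph $K(n,k)$ has as vertices the $k$-element subsets of $[n]=\{1,\dots,n\}$, two vertices being adjacent iff they are disjoint. A vertex cut is a set $S$ of vertices whose removal disconnects the graph; $c(G\setminus S)$ is the number of connected components after deleting $S$; the toughness is $t(G)=\min_S |S|/c(G\setminus S)$ over vertex cuts $S$. *)

(* Defs.v *)
From HB Require Import structures.
From mathcomp Require Import all_boot all_order all_algebra.
Set Implicit Arguments. Unset Strict Implicit. Unset Printing Implicit Defensive.
Import Order.TTheory GRing.Theory Num.Theory.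

(* A finite simple graph is given by a vertex finType V and an adjacency
   relation adj : rel V (for the Kneser graph it is symmetric and irreflexive). *)

Section Graphs.
Variables (V : finType) (adj : rel V).

Definition adj_del (S : {set V}) : rel V :=
  fun x y => [&& x \notin S, y \notin S & adj x y].

Definition components (S : {set V}) : {set {set V}} :=
  [set [set y | connect (adj_del S) x y] | x in ~: S].

Definition ncomp (S : {set V}) : nat := #|components S|.

Definition is_vertex_cut (S : {set V}) : bool := 2 <= ncomp S.

Definition cut_ratio (S : {set V}) : rat := (#|S|%:R / (ncomp S)%:R)%R.

(* t(G) = min over vertex cuts S of |S| / c(G \ S).  If G has no vertex cut
   (complete graphs) the value is the conventional default #|V|. *)
Definition toughness : rat :=
  \big[Num.min/(#|V|%:R)%R]_(S : {set V} | is_vertex_cut S) cut_ratio S.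

Definition independent (I : {set V}) : bool :=
  [forall x in I, forall y in I, ~~ adj x y].

Definition max_independent (I : {set V}) : bool :=
  independent I && [forall J : {set V}, independent J ==> (#|J| <= #|I|)].

End Graphs.

Definition kvert (n k : nat) : predArgType := {A : {set 'I_n} | #|A| == k}.
HB.instance Definition _ n k := Finite.on (kvert n k).

Definition kneser_adj (n k : nat) : rel (kvert n k) :=
  fun A B => [disjoint val A & val B].

(* Main.v *)
(* Put r = n/4 - 1, N = C(n,4) and a = C(n-1,3), so N = (r + 1) a, and let d be
   the degree of K(n,4).  Its smallest eigenvalue is - tau = - d/r, and all its
   eigenvalues other than d are at most theta = C(n-6,2).  Hence a component of
   size m of G \ S has average degree at most delta, where delta = 0 if m = 1 and
   delta = theta + (d - theta) m/N otherwise.  Testing the lower bound - tau on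
   the vector with value tau/(tau + delta) on each component gives
     sum of w(m) <= a, where w(m) = m tau/(tau + delta).
   An elementary estimate shows (r + 1) w(m) >= m + r for all possible sizes m,
   with equality only for m = 1.  Summing over the c components,
     N - |S| + r c <= (r + 1) a = N, i.e. r c <= |S|,
   and equality forces every component to be a single vertex and
   N - |S| = a. *)

Require Import Defs.
From HB Require Import structures.
From mathcomp Require Import all_boot all_order all_algebra.
From mathcomp Require Import ring lra.
Import Order.TTheory GRing.Theory Num.Theory.

Set Implicit Arguments.
Unset Strict Implicit.
Unset Printing Implicit Defensive.

Local Open Scope ring_scope.

(** * Raising and lowering operators on functions of subsets, and harmonic parts *)

Section SetFunctions.

Variables (T : finType) (R : realFieldType).
Local Notation sfun := {ffun {set T} -> R^o}.
Implicit Types (f g : sfun) (P A B : {set T}).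

Definition up f : sfun := [ffun P : {set T} => \sum_(x in P) f (P :\ x)].
Definition down f : sfun := [ffun P : {set T} => \sum_(x in ~: P) f (x |: P)].
Definition dot f g : R := \sum_P f P * g P.
Definition level (i : nat) f := forall P, #|P| != i -> f P = 0.

Fact up_is_linear : linear up.
Proof.
move=> a f g; apply/ffunP=> P; rewrite !ffunE scaler_sumr -big_split.
by apply: eq_bigr => x _; rewrite !ffunE.
Qed.
HB.instance Definition _ := GRing.isLinear.Build R sfun sfun _ up up_is_linear.

Fact down_is_linear : linear down.
Proof.
move=> a f g; apply/ffunP=> P; rewrite !ffunE scaler_sumr -big_split.
by apply: eq_bigr => x _; rewrite !ffunE.
Qed.
HB.instance Definition _ :=
  GRing.isLinear.Build R sfun sfun _ down down_is_linear.

Lemma dotC f g : dot f g = dot g f.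
Proof. by apply: eq_bigr => P _; rewrite mulrC. Qed.

Lemma dotDl f1 f2 g : dot (f1 + f2) g = dot f1 g + dot f2 g.
Proof. by rewrite -big_split; apply: eq_bigr => P _; rewrite ffunE mulrDl. Qed.

Lemma dotZl a f g : dot (a *: f) g = a * dot f g.
Proof. by rewrite mulr_sumr; apply: eq_bigr => P _; rewrite ffunE mulrA. Qed.

Lemma dot0l g : dot 0 g = 0.
Proof. by apply: big1 => P _; rewrite ffunE mul0r. Qed.

Lemma dot_suml (I : finType) (F : I -> sfun) g :
  dot (\sum_i F i) g = \sum_i dot (F i) g.
Proof. exact: (big_morph (dot^~ g) (fun f1 f2 => dotDl f1 f2 g) (dot0l g)). Qed.

Lemma dot_ge0 f : 0 <= dot f f.
Proof. by apply: sumr_ge0 => P _; rewrite -expr2 sqr_ge0. Qed.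

(** Both sides sum over pairs of a set and a point outside it; the reindexing is [P = x |: P']. *)
Lemma dot_up f g : dot (up f) g = dot f (down g).
Proof.
transitivity (\sum_(P : {set T}) \sum_(x in P) f (P :\ x) * g P).
  by apply: eq_bigr => P _; rewrite ffunE mulr_suml.
transitivity (\sum_(P : {set T}) \sum_(x in ~: P) f P * g (x |: P)); last first.
  by apply: eq_bigr => P _; rewrite ffunE mulr_sumr.
rewrite (exchange_big_dep predT) // [RHS](exchange_big_dep predT) //=.
apply: eq_bigr => x _.
rewrite (reindex_onto (fun P => x |: P) (fun P => P :\ x)) /=; last first.
  by move=> P; apply: setD1K.
rewrite (eq_bigl (fun P => x \in ~: P)) => [|P]; last first.
  rewrite setU11 inE; apply/eqP/idP => [<-|]; first by rewrite !inE eqxx.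
  exact: setU1K.
by apply: eq_bigr => P; rewrite inE => xP; rewrite setU1K.
Qed.

Lemma dot_iter_up a f g : dot (iter a up f) g = dot f (iter a down g).
Proof. by elim: a g => // a IHa g; rewrite iterS dot_up IHa iterSr. Qed.

Lemma down_level i f : level i f -> level i.-1 (down f).
Proof.
move=> fi P Pi; rewrite ffunE big1 // => x; rewrite inE => xP.
by apply: fi; rewrite cardsU1 xP; apply: contraNN Pi => /eqP <-.
Qed.

Lemma down_level0 f : level 0 f -> down f = 0.
Proof.
move=> f0; apply/ffunP=> P; rewrite !ffunE big1 // => x; rewrite inE => xP.
by apply: f0; rewrite cardsU1 xP.
Qed.

Lemma iter_down_level a i f : level i f -> level (i - a)%N (iter a down f).
Proof.
by elim: a => [|a IHa] fi; rewrite ?subn0 // subnS; apply/down_level/IHa.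
Qed.

Lemma up_level i f : level i f -> level i.+1 (up f).
Proof.
move=> fi P Pi; rewrite ffunE big1 // => x xP; apply: fi.
by apply: contraNN Pi => /eqP <-; rewrite [#|P|](cardsD1 x) xP.
Qed.

Lemma iter_up_level a i f : level i f -> level (a + i)%N (iter a up f).
Proof. by elim: a => // a IHa fi; apply/up_level/IHa. Qed.

(** Adding [x] and then removing [y != x] commutes with the reverse order, so these terms ([M])
    cancel. Adding and removing the same point leaves [#|~: P| - #|P|] copies of [f P]. *)
Lemma down_up i f : level i f ->
  down (up f) = up (down f) + (#|T|%:R - (2 * i)%:R) *: f.
Proof.
move=> fi; apply/ffunP=> P; rewrite !ffunE /=.
pose M := \sum_(x in ~: P) \sum_(y in P) f (x |: (P :\ y)).
have -> : \sum_(x in ~: P) up f (x |: P) = #|~: P|%:R * f P + M.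
  rewrite mulr_natl -sumr_const -big_split; apply: eq_bigr => x.
  rewrite inE => xP; rewrite ffunE big_setU1 //= setU1K //; congr (_ + _).
  apply: eq_bigr => y yP; congr (f _); rewrite setDUl; congr (_ :|: _).
  apply/setP=> z; rewrite !inE andbC; case: (z =P x) => //= ->.
  by apply: contraNN xP => /eqP ->.
have -> : \sum_(x in P) down f (P :\ x) = #|P|%:R * f P + M.
  rewrite /M exchange_big mulr_natl -sumr_const -big_split.
  apply: eq_bigr => y yP; rewrite ffunE setCD setUC big_setU1 ?inE ?yP //=.
  by rewrite setD1K.
have [Pi|/fi ->] := eqVneq #|P| i; last by rewrite scaler0 !mulr0 addr0.
have scE (a b : R) : a *: (b : R^o) = a * b by [].
rewrite -Pi -(cardsC P) scE natrM natrD; ring.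
Qed.

(** The commutator acts at levels [i], ..., [i + a], and the scalars [#|T| - 2 (i + b)] for [b <= a]
    add up to the coefficient. *)
Lemma down_iter_up a i f : level i f ->
  down (iter a.+1 up f) = iter a.+1 up (down f) +
    (a.+1%:R * (#|T|%:R - (2 * i + a)%:R)) *: iter a up f.
Proof.
move=> fi; elim: a => [|a IHa]; first by rewrite /= (down_up fi) mul1r addn0.
rewrite [iter a.+2 up f]/(up _) (down_up (@iter_up_level a.+1 _ _ fi)) IHa.
rewrite linearD linearZ -addrA -scalerDl; congr (_ + _ *: _).
by rewrite !natrD !natrM natrD -!natr1; ring.
Qed.

(** With [c = #|T| - 2 i] these solve [t (a+1) * (a+1) * (c + a + 2) = - t a], the condition for
    [down] to kill the sum of [t a *: up^a (down^a f)] over [a <= i]. *)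
Definition harmonic_coef (c : R) a : R :=
  \prod_(b < a) - (b.+1%:R * (c + b.+2%:R))^-1.

(* The function [h] in the proof is the orthogonal projection of [f] onto the
   kernel of [down], and the right-hand side is its squared norm. *)
Lemma harmonic_norm_ge0 i f : level i f -> (2 * i <= #|T|)%N ->
  0 <= \sum_(a < i.+1) harmonic_coef (#|T|%:R - (2 * i)%:R) a *
         dot (iter a down f) (iter a down f).
Proof.
move=> fi iT; set c := _ - _; pose t := harmonic_coef c.
have c_ge0 : 0 <= c by rewrite subr_ge0 ler_nat.
pose hs m := \sum_(a < m) t a *: iter a up (iter a down f).
(* Telescoping: [down] of each new summand cancels what the earlier ones left, so only the top term
   survives. For [m = i] that term is zero as well. *)
have dhs m : (m <= i)%N ->
    down (hs m.+1) = t m *: iter m up (iter m.+1 down f).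
  elim: m => [|m IHm] mi.
    by rewrite /hs big_ord1 linearZ.
  rewrite /hs big_ord_recr -/(hs m.+1) /=.
  rewrite linearD linearZ /= IHm ?(ltnW mi) //.
  rewrite -/(iter m.+1 up _) (down_iter_up _ (@iter_down_level m.+1 _ _ fi)).
  rewrite scalerDr addrCA scalerA -scalerDl [X in _ + X *: _](_ : _ = 0).
    by rewrite scale0r addr0.
  rewrite /t /harmonic_coef big_ord_recr /=.
  have -> : #|T|%:R - (2 * (i - m.+1) + m)%:R = c + m.+2%:R :> R.
    rewrite /c natrD !natrM natrB // -!natr1; ring.
  have c2 : c + m.+2%:R != 0 by rewrite gt_eqF // ltr_wpDl.
  have m1 : m.+1%:R != 0 :> R by rewrite pnatr_eq0.
  by field; rewrite -natrD nat1r c2.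
have dh : down (hs i.+1) = 0.
  have D0 : iter i.+1 down f = 0.
    by apply: down_level0; rewrite -(subnn i); apply: iter_down_level.
  rewrite dhs // D0.
  by elim: (i) (t i) => [|m /= IHm] k; rewrite ?scaler0 // -linearZ IHm linear0.
have hdot a g : dot (iter a.+1 up g) (hs i.+1) = 0.
  by rewrite iterS dot_up dh dotC dot0l.
suff -> : \sum_(a < i.+1) t a * dot (iter a down f) (iter a down f) =
          dot (hs i.+1) (hs i.+1) by apply: dot_ge0.
rewrite [in X in dot X _]/hs dot_suml [RHS]big_ord_recl.
rewrite [X in _ + X]big1 => [|a _]; last by rewrite dotZl hdot mulr0.
rewrite [t ord0]big_ord0 scale1r addr0 /= dotC /hs dot_suml.
by apply: eq_bigr => a _; rewrite dotZl dot_iter_up.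
Qed.

(** Expand the product of [F x + 1] with [F = -1] on [E] and [0] elsewhere; any point of [E] gives a
    zero factor. *)
Lemma sum_signed_subsets (E : {set T}) :
  \sum_(P : {set T} | P \subset E) (-1) ^+ #|P| = (E == set0)%:R :> R.
Proof.
pose F x : R := if x \in E then -1 else 0.
transitivity (\prod_x (F x + 1)).
  rewrite bigA_distr big_mkcond; apply: eq_bigr => P _.
  rewrite -big_mkcond /=; case: ifPn => [PE|/subsetPn [x xP xE]].
    rewrite -prodr_const; apply: eq_bigr => x xP.
    by rewrite /F (subsetP PE).
  by rewrite (bigD1 x) //= /F (negPf xE) mul0r.
have [E0|[x xE]] := set_0Vmem E.
  by rewrite E0 eqxx big1 // => x _; rewrite /F E0 inE add0r.
have /negPf -> : E != set0 by apply/set0Pn; exists x.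
by rewrite (bigD1 x) //= /F xE addNr mul0r.
Qed.

(** For [f] at level [k] and [i <= k], this is [down] applied [k - i] times to [f], divided by
    [(k - i)!]. *)
Definition shadow f (i : nat) : sfun :=
  [ffun P : {set T} =>
     if #|P| == i then \sum_(A : {set T} | P \subset A) f A else 0].

Lemma shadow_level f i : level i (shadow f i).
Proof. by move=> P Pi; rewrite ffunE (negPf Pi). Qed.

Lemma shadow_id k f : level k f -> shadow f k = f.
Proof.
move=> fk; apply/ffunP=> P; rewrite ffunE; case: ifPn => [/eqP Pk|/fk //].
rewrite (bigD1 P) //= big1 ?addr0 // => A /andP [PA AP]; apply: fk.
apply: contraNN AP => /eqP Ak; rewrite eq_sym eqEcard PA.
by rewrite Ak Pk leqnn.
Qed.

Lemma dot_shadow0 f : dot (shadow f 0) (shadow f 0) = (\sum_A f A) ^+ 2.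
Proof.
rewrite /dot (bigD1 set0) //= big1 => [|P P0]; last first.
  by rewrite ffunE cards_eq0 (negPf P0) mul0r.
rewrite addr0 ffunE cards0 eqxx -expr2; congr (_ ^+ 2).
by apply: eq_bigl => A; rewrite sub0set.
Qed.

(** A [k]-set [A] above a [j]-set [P] is counted once for each of the [k - j] points of
    [A :\: P]. *)
Lemma down_shadow k j f : level k f ->
  down (shadow f j.+1) = (k - j)%:R *: shadow f j.
Proof.
move=> fk; apply/ffunP=> P; rewrite !ffunE.
have [Pj|Pj] := eqVneq #|P| j; last first.
  rewrite scaler0 big1 // => x; rewrite inE => xP.
  by rewrite ffunE cardsU1 xP add1n eqSS (negPf Pj).
rewrite [RHS](_ : _ = \sum_(A : {set T} | P \subset A)
                       \sum_(x in A :\: P) f A).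
  transitivity (\sum_(x in ~: P) \sum_(A : {set T} | x |: P \subset A) f A).
    by apply: eq_bigr => x; rewrite inE ffunE cardsU1 Pj => ->; rewrite eqxx.
  rewrite (exchange_big_dep (fun A => P \subset A)) /= => [|x A _]; last first.
    by apply/subset_trans/subsetUr.
  apply: eq_bigr => A PA; apply: eq_bigl => x.
  by rewrite subUset sub1set PA !inE andbT.
rewrite scaler_sumr; apply: eq_bigr => A PA; rewrite sumr_const.
have [Ak|/fk ->] := eqVneq #|A| k; last by rewrite scaler0 mul0rn.
by rewrite cardsDS // Ak Pj scaler_nat.
Qed.

Lemma iter_down_shadow k a j f : level k f ->
  iter a down (shadow f (j + a)) = ((k - j) ^_ a)%:R *: shadow f j.
Proof.
move=> fk; elim: a j => [|a IHa] j; first by rewrite addn0 scale1r.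
rewrite -addSnnS iterS IHa linearZ /= (down_shadow _ fk) scalerA -natrM.
by rewrite mulnC ffactnS subnS.
Qed.

(** Inclusion-exclusion: the indicator of disjointness is the signed sum over [P \subset A :&: B].
    Exchanging sums yields one square for each [P], and these are grouped by [#|P|]. *)
Lemma disjoint_form k f : level k f ->
  \sum_(A : {set T}) \sum_(B : {set T}) f A * f B * [disjoint A & B]%:R =
  \sum_(j < k.+1) (-1) ^+ j * dot (shadow f j) (shadow f j).
Proof.
move=> fk; pose s P : R := \sum_(A : {set T} | P \subset A) f A.
transitivity (\sum_(P : {set T}) (-1) ^+ #|P| * s P ^+ 2).
  transitivity (\sum_(A : {set T}) \sum_(B : {set T})
                  \sum_(P : {set T} | P \subset A :&: B)
                  f A * f B * (-1) ^+ #|P| : R).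
    apply: eq_bigr => A _; apply: eq_bigr => B _.
    by rewrite -mulr_sumr sum_signed_subsets setI_eq0.
  under eq_bigr do rewrite (exchange_big_dep predT) //=.
  rewrite exchange_big /=; apply: eq_bigr => P _.
  rewrite expr2 mulrA {2}/s mulr_sumr [RHS]big_mkcond; apply: eq_bigr => A _.
  case: ifP => PA; last by rewrite big1 // => B; rewrite subsetI PA.
  rewrite /s mulr_sumr mulr_suml.
  rewrite (eq_bigl (fun B => P \subset B)) => [|B]; last by rewrite subsetI PA.
  by apply: eq_bigr => B _; ring.
have s0 P : (k < #|P|)%N -> s P = 0.
  move=> kP; rewrite /s big1 // => A PA; apply: fk.
  by rewrite gtn_eqF // (leq_trans kP) ?subset_leq_card.
rewrite (bigID (fun P : {set T} => (#|P| < k.+1)%N)) /= addrC.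
rewrite big1 ?add0r => [|P].
  rewrite (partition_big (fun P : {set T} => inord #|P| : 'I_k.+1) predT) //=.
  apply: eq_bigr => j _; rewrite /dot mulr_sumr big_mkcond.
  apply: eq_bigr => P _.
  rewrite !ffunE; have [Pj|Pj] := eqVneq #|P| j.
    by rewrite Pj ltn_ord inord_val eqxx expr2.
  case: ifP => [/andP [Pk /eqP jP]|]; last by rewrite !mulr0.
  by rewrite -jP inordK ?eqxx in Pj.
by rewrite -leqNgt => Pk; rewrite s0 // expr0n mulr0.
Qed.

(** The harmonic part of [shadow f i] has nonnegative squared norm; since [down] maps shadows to
    multiples of shadows, this is a linear inequality between shadow norms. *)
Lemma shadow_norm_ge0 k i f : level k f -> (2 * i <= #|T|)%N ->
  0 <= \sum_(a < i.+1) harmonic_coef (#|T|%:R - (2 * i)%:R) a *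
         (((k - (i - a)) ^_ a)%:R ^+ 2 *
          dot (shadow f (i - a)) (shadow f (i - a))).
Proof.
move=> fk iT; have := harmonic_norm_ge0 (@shadow_level f i) iT.
congr (0 <= _); apply: eq_bigr => a _; congr (_ * _).
have ai : (a <= i)%N by rewrite -ltnS.
have := iter_down_shadow a (i - a) fk; rewrite subnK // => ->.
by rewrite dotZl dotC dotZl mulrA.
Qed.

End SetFunctions.

(** * Spectral bounds for the disjointness form on 4-subsets *)

Section KneserSpectrum.

Variable R : realFieldType.
Implicit Type v : R.

(** Binomial coefficients as polynomials in [v]: here C(v,4), then C(v-4,4), C(v-1,3), C(v-5,3) and
    C(v-6,2). *)
Definition kneser_order v := v * (v - 1) * (v - 2) * (v - 3) / 24.
Definition kneser_degree v := (v - 4) * (v - 5) * (v - 6) * (v - 7) / 24.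
Definition star_size v := (v - 1) * (v - 2) * (v - 3) / 6.
(* The eigenvalues of K(n,4) other than the degree lie in [- tau, theta]. *)
Definition tau v := (v - 5) * (v - 6) * (v - 7) / 6.
Definition theta v := (v - 6) * (v - 7) / 2.

Variables (T : finType) (f : {ffun {set T} -> R^o}) (v : R).
Hypotheses (vE : #|T|%:R = v) (v_ge9 : 9 <= v) (f4 : level 4 f).

Local Notation q i := (dot (shadow f i) (shadow f i)).

Let T_ge9 : (9 <= #|T|)%N. Proof. by rewrite -(ler_nat R) vE. Qed.

Let expandE :=
  (mul1r, leq0n, leqnn, add1n, add0n, addn0, subSS, subn0, ffactn0, ffactnn).

(** This and the next three are [shadow_norm_ge0] for [i = 1, 2, 3, 4]; each coefficient is a
    [harmonic_coef] times a squared falling factorial. *)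
Lemma shadow1_ge0 : 0 <= q 1 - 16 / v * q 0.
Proof.
have v9 := v_ge9.
have := shadow_norm_ge0 (i := 1) f4 (leq_trans (isT : 2 <= 9)%N T_ge9).
rewrite vE /harmonic_coef !big_ord_recl !big_ord0 /= /bump /= !expandE.
congr (0 <= _); rewrite !ffactn1; field; rewrite ?lt0r_neq0 //; lra.
Qed.

Lemma shadow2_ge0 :
  0 <= q 2 - 9 / (v - 2) * q 1 + 72 / ((v - 1) * (v - 2)) * q 0.
Proof.
have v9 := v_ge9.
have := shadow_norm_ge0 (i := 2) f4 (leq_trans (isT : 4 <= 9)%N T_ge9).
rewrite vE /harmonic_coef !big_ord_recl !big_ord0 /= /bump /= !expandE.
congr (0 <= _); rewrite !ffactn1 (_ : 4 ^_ 2 = 12)%N //.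
field; rewrite ?lt0r_neq0 //; lra.
Qed.

Lemma shadow3_ge0 :
  0 <= q 3 - 4 / (v - 4) * q 2 + 18 / ((v - 3) * (v - 4)) * q 1
       - 96 / ((v - 2) * (v - 3) * (v - 4)) * q 0.
Proof.
have v9 := v_ge9.
have := shadow_norm_ge0 (i := 3) f4 (leq_trans (isT : 6 <= 9)%N T_ge9).
rewrite vE /harmonic_coef !big_ord_recl !big_ord0 /= /bump /= !expandE.
congr (0 <= _); rewrite !ffactn1 (_ : 3 ^_ 2 = 6)%N //.
rewrite (_ : 4 ^_ 3 = 24)%N //; field; rewrite ?lt0r_neq0 //; lra.
Qed.

Lemma shadow4_ge0 :
  0 <= q 4 - 1 / (v - 6) * q 3 + 2 / ((v - 5) * (v - 6)) * q 2
       - 6 / ((v - 4) * (v - 5) * (v - 6)) * q 1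
       + 24 / ((v - 3) * (v - 4) * (v - 5) * (v - 6)) * q 0.
Proof.
have v9 := v_ge9.
have := shadow_norm_ge0 (i := 4) f4 (leq_trans (isT : 8 <= 9)%N T_ge9).
rewrite vE /harmonic_coef !big_ord_recl !big_ord0 /= /bump /= !expandE.
congr (0 <= _); rewrite !factE !mulnE /=; field; rewrite ?lt0r_neq0 //; lra.
Qed.

Local Notation form :=
  (\sum_(A : {set T}) \sum_(B : {set T}) f A * f B * [disjoint A & B]%:R).

Lemma formE : form = q 0 - q 1 + q 2 - q 3 + q 4.
Proof.
rewrite (disjoint_form f4) !big_ord_recl big_ord0 /bump /=; ring.
Qed.

(** The difference of the two sides is a nonnegative combination of the shadow inequalities for
    [i = 2, 3, 4]. On the harmonic components of degree 0 and 1 the bound is an equality. *)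
Lemma disjoint_form_ge :
  tau v / star_size v * (\sum_A f A) ^+ 2 - tau v * dot f f <= form.
Proof.
have v9 := v_ge9; have -> : dot f f = q 4 by rewrite (shadow_id f4).
rewrite -dot_shadow0 formE -subr_ge0.
(* The numerators are the gaps between the eigenvalues [theta v], [- (v - 7)], [1] of degrees 2, 3,
   4 and [- tau v]. The denominators C(v-2i,4-i) are the factors by which the [i]-th shadow scales
   the squared norm in degree [i]. *)
have c2 : 0 <= (theta v + tau v) * 2 / ((v - 4) * (v - 5)).
  by rewrite /theta /tau !(subr_ge0, mulr_ge0, addr_ge0, invr_ge0) //; lra.
have c3 : 0 <= (tau v - (v - 7)) / (v - 6).
  rewrite divr_ge0 //; last lra.
  have : 0 <= ((v - 5) * (v - 6) - 6) / 6 * (v - 7) by apply: mulr_ge0; nra.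
  by congr (0 <= _); rewrite /tau; field.
have c4 : 0 <= 1 + tau v.
  by rewrite /tau !(subr_ge0, mulr_ge0, addr_ge0, invr_ge0) //; lra.
have := addr_ge0 (addr_ge0 (mulr_ge0 c2 shadow2_ge0) (mulr_ge0 c3 shadow3_ge0))
                 (mulr_ge0 c4 shadow4_ge0).
congr (0 <= _); rewrite /theta /tau /star_size; field.
all: rewrite ?lt0r_neq0 //; lra.
Qed.

(** As for the lower bound, with the gaps measured down from [theta v]; equality now holds in
    degrees 0 and 2, and the weights belong to degrees 1, 3, 4. *)
Lemma disjoint_form_le :
  form <= theta v * dot f f +
    (kneser_degree v - theta v) / kneser_order v * (\sum_A f A) ^+ 2.
Proof.
have v9 := v_ge9; have -> : dot f f = q 4 by rewrite (shadow_id f4).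
rewrite -dot_shadow0 formE -subr_ge0.
have c1 : 0 <= (theta v + tau v) * 6 / ((v - 2) * (v - 3) * (v - 4)).
  by rewrite /theta /tau !(subr_ge0, mulr_ge0, addr_ge0, invr_ge0) //; lra.
have c3 : 0 <= (theta v + (v - 7)) / (v - 6).
  by rewrite /theta !(subr_ge0, mulr_ge0, addr_ge0, invr_ge0) //; lra.
have c4 : 0 <= theta v - 1 by rewrite /theta; nra.
have := addr_ge0 (addr_ge0 (mulr_ge0 c1 shadow1_ge0) (mulr_ge0 c3 shadow3_ge0))
                 (mulr_ge0 c4 shadow4_ge0).
congr (0 <= _); rewrite /theta /tau /kneser_degree /kneser_order; field.
all: rewrite ?lt0r_neq0 //; lra.
Qed.

End KneserSpectrum.

(** * Components left after deleting a vertex set *)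

Section Components.

Variables (V : finType) (adj : rel V) (S : {set V}).
Hypotheses (adjC : symmetric adj).

Definition component x := [set y | connect (adj_del adj S) x y].

Lemma component_refl x : x \in component x.
Proof. by rewrite inE connect0. Qed.

Lemma component_eq x y : y \in component x -> component y = component x.
Proof.
rewrite inE => xy; apply/setP=> z; rewrite !inE; apply/esym/same_connect => //.
by apply: sym_connect_sym => a b; rewrite /adj_del adjC andbCA.
Qed.

Lemma component_sub x : x \notin S -> component x \subset ~: S.
Proof.
move=> xS; apply/subsetP=> y; rewrite !inE => xy.
have cS : closed (adj_del adj S) (~: S).
  by move=> a b /and3P [aS bS _]; rewrite !inE aS bS.
by have := closed_connect cS xy; rewrite !inE xS.
Qed.

Lemma component_adj x y :
  x \notin S -> y \notin S -> adj x y -> y \in component x.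
Proof. by move=> xS yS xy; rewrite inE connect1 // /adj_del xS yS. Qed.

Lemma componentsP C :
  reflect (exists2 x, x \notin S & C = component x) (C \in components adj S).
Proof.
apply: (iffP imsetP) => [] [x xS ->]; exists x => //.
  by rewrite -in_setC.
by rewrite in_setC.
Qed.

Lemma components_eq C x : C \in components adj S -> x \in C -> C = component x.
Proof. by case/componentsP=> y _ -> /component_eq. Qed.

Lemma components_notin C x : C \in components adj S -> x \in C -> x \notin S.
Proof.
by case/componentsP=> y yS -> xC; rewrite -in_setC (subsetP (component_sub yS)).
Qed.

Lemma sum_components (R : nmodType) (F : V -> R) :
  \sum_(x in ~: S) F x = \sum_(C in components adj S) \sum_(x in C) F x.
Proof.
rewrite (partition_big_imset component); apply: eq_bigr => C CS.
apply: eq_bigl => x; apply/andP/idP => [[_ /eqP <-]|xC].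
  exact: component_refl.
by rewrite in_setC (components_notin CS xC) (components_eq CS xC).
Qed.

(** Ordered pairs are counted, so this is the sum of the degrees inside [C]. *)
Definition edge_sum (C : {set V}) : nat :=
  \sum_(x in C) \sum_(y in C) adj x y.

Variables (R : realFieldType).

(** [g] vanishes on [S], and no edge outside [S] joins two different components. *)
Lemma weighted_edge_sum (s : {set V} -> R) :
  let g x := if x \in S then 0 else s (component x) in
  \sum_x \sum_y g x * g y * (adj x y)%:R =
    \sum_(C in components adj S) s C ^+ 2 * (edge_sum C)%:R.
Proof.
move=> g; rewrite (bigID (mem S)) /= big1 ?add0r => [|x xS]; last first.
  by rewrite big1 // => y _; rewrite /g xS !mul0r.
rewrite (eq_bigl (fun x => x \in ~: S)) => [|x]; last by rewrite in_setC.
rewrite sum_components; apply: eq_bigr => C CS.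
rewrite natr_sum mulr_sumr; apply: eq_bigr => x xC.
have xS := components_notin CS xC; rewrite natr_sum mulr_sumr [RHS]big_mkcond.
apply: eq_bigr => y _; rewrite {1}/g (negPf xS) -(components_eq CS xC) /g.
have [yC|yC] := boolP (y \in C).
  by rewrite (negPf (components_notin CS yC)) -(components_eq CS yC) expr2.
have [yS|yS] := boolP (y \in S); first by rewrite mulr0 mul0r.
have [xy|//] := boolP (adj x y); last by rewrite mulr0.
by rewrite (components_eq CS xC) component_adj in yC.
Qed.

(* The ratio bound tested on the vector that is constant on each component,
   with the optimal constants [t / (t + d C)]. *)
Lemma component_weight_bound (t a : R) (d : {set V} -> R) : 0 < t -> 0 < a ->
  (forall g : V -> R, t / a * (\sum_x g x) ^+ 2 - t * \sum_x g x ^+ 2 <=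
     \sum_x \sum_y g x * g y * (adj x y)%:R) ->
  (forall C, C \in components adj S ->
     0 <= d C /\ (edge_sum C)%:R <= d C * #|C|%:R) ->
  \sum_(C in components adj S) #|C|%:R * (t / (t + d C)) <= a.
Proof.
move=> t_gt0 a_gt0 bound dC; set W := \sum_(C in _) _.
pose s C := t / (t + d C); pose g x := if x \in S then 0 else s (component x).
have sumg k : (0 < k)%N ->
    \sum_x g x ^+ k = \sum_(C in components adj S) #|C|%:R * s C ^+ k.
  move=> k_gt0; rewrite (bigID (mem S)) /= big1 ?add0r => [|x xS]; last first.
    by rewrite /g xS expr0n gtn_eqF.
  rewrite (eq_bigl (fun x => x \in ~: S)) => [|x]; last by rewrite in_setC.
  rewrite sum_components; apply: eq_bigr => C CS; rewrite mulr_natl -sumr_const.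
  apply: eq_bigr => x xC; rewrite /g (negPf (components_notin CS xC)).
  by rewrite -(components_eq CS xC).
have sumg1 : \sum_x g x = W.
  exact: (sumg 1%N isT).
have := bound g; rewrite sumg1 sumg // weighted_edge_sum => leW.
have {}leW : t / a * W ^+ 2 <= t * W.
  rewrite lerBlDr in leW; apply: le_trans leW _.
  rewrite /W !mulr_sumr -big_split /=; apply: ler_sum => C CS.
  have [d_ge0 eC] := dC C CS.
  (* The constant [s C] is chosen so that [s^2 * (d + t) = t * s], which turns the quadratic
     estimate into [t * W]. *)
  have -> : t * (#|C|%:R * (t / (t + d C))) =
            s C ^+ 2 * (d C * #|C|%:R) + t * (#|C|%:R * s C ^+ 2).
    by rewrite /s; field; rewrite gt_eqF // ltr_pwDl.
  by rewrite lerD2r ler_wpM2l // sqr_ge0.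
have [W_le0|W_gt0] := leP W 0; first exact: le_trans W_le0 (ltW a_gt0).
by move: leW; rewrite expr2 mulrA ler_pM2r // mulrAC ler_pdivrMr // ler_pM2l.
Qed.

End Components.

(** A path starting in [I] has no first step, so the components are the singletons of [I]. *)
Lemma ncomp_independent (V : finType) (adj : rel V) (I : {set V}) :
  independent adj I -> ncomp adj (~: I) = #|I|.
Proof.
move=> /'forall_in_'forall_in_idP indep.
rewrite -(card_imset I (@set1_inj V)) /ncomp; congr #|pred_of_set _|.
rewrite /components setCK; apply: eq_in_imset => x xI.
apply/setP=> y; rewrite !inE eq_sym; apply/idP/eqP => [|->]; last exact: connect0.
case/connectP=> [] [|z p] /= => [_ ->//|/andP []].
by case/and3P; rewrite !inE !negbK => _ zI; rewrite (negPf (indep x xI z zI)).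
Qed.

(** * Numerical estimates for the component weights *)

Section Weights.

Variables (R : realFieldType) (v : R).
Implicit Type x : R.

Definition component_density x :=
  theta v + (kneser_degree v - theta v) / kneser_order v * x.

Lemma kneser_orderE : kneser_order v = v / 4 * star_size v.
Proof. by rewrite /kneser_order /star_size; field. Qed.

Lemma kneser_order_gt : 13 <= v -> v < kneser_order v.
Proof.
move=> v13; rewrite -subr_gt0.
(* Division of the cubic by [v - 13]; the remainder 1296 is its value at 13. *)
have -> : kneser_order v - v =
          v / 24 * ((v - 13) * (v ^+ 2 + 7 * v + 102) + 1296).
  by rewrite /kneser_order; field.
apply: mulr_gt0; nra.
Qed.

Lemma kneser_degree_ge : 13 <= v -> v - 1 <= kneser_degree v.
Proof.
move=> v13; have h1 : 8 * 7 <= (v - 5) * (v - 6) by apply: ler_pM; lra.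
have h2 : 8 * 7 * 6 <= (v - 5) * (v - 6) * (v - 7) by apply: ler_pM; lra.
have : (v - 4) * (8 * 7 * 6) <= (v - 4) * ((v - 5) * (v - 6) * (v - 7)).
  by apply: ler_wpM2l => //; lra.
rewrite /kneser_degree !mulrA; lra.
Qed.

Lemma tau_gt0 : 13 <= v -> 0 < tau v.
Proof. by move=> v13; rewrite /tau !mulr_gt0 ?subr_gt0 ?invr_gt0 //; lra. Qed.

Lemma star_size_gt1 : 13 <= v -> 1 < star_size v.
Proof.
move=> v13; rewrite /star_size ltr_pdivlMr // mul1r.
have h : 12 * 11 <= (v - 1) * (v - 2) by apply: ler_pM; lra.
have : 12 * 11 * 10 <= (v - 1) * (v - 2) * (v - 3) by apply: ler_pM; lra.
lra.
Qed.

Lemma theta_ge0 : 13 <= v -> 0 <= theta v.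
Proof. by move=> v13; rewrite /theta !mulr_ge0 ?subr_ge0 ?invr_ge0 //; lra. Qed.

Lemma degree_sub_thetaE :
  kneser_degree v - theta v = (v - 1) * (v - 6) * (v - 7) * (v - 8) / 24.
Proof. by rewrite /kneser_degree /theta; field. Qed.

Lemma degree_sub_theta_ge0 : 13 <= v -> 0 <= kneser_degree v - theta v.
Proof.
move=> v13; rewrite degree_sub_thetaE !mulr_ge0 ?subr_ge0 ?invr_ge0 //; lra.
Qed.

Lemma component_density_ge0 x : 13 <= v -> 0 <= x -> 0 <= component_density x.
Proof.
move=> v13 x_ge0; have N_gt := kneser_order_gt v13.
rewrite /component_density addr_ge0 ?theta_ge0 // mulr_ge0 //.
by rewrite divr_ge0 ?degree_sub_theta_ge0 //; lra.
Qed.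

(** After clearing denominators the difference is a concave quadratic in [x], so positivity at
    [x = 2] and a bound on the far end suffice. *)
Lemma component_weight_gt x : 13 <= v -> 2 <= x -> x <= kneser_order v - v ->
  x + (v / 4 - 1) < v / 4 * (x * (tau v / (tau v + component_density x))).
Proof.
move=> v13 x2 xN; have N_gt := kneser_order_gt v13; have t_gt0 := tau_gt0 v13.
have x_ge0 : 0 <= x by lra.
have D_ge0 := component_density_ge0 v13 x_ge0.
rewrite (mulrA x) (mulrA (v / 4)) ltr_pdivlMr ?ltr_pwDl // -subr_gt0.
have N_gt0 : 0 < kneser_order v by lra.
rewrite -(pmulr_rgt0 _ N_gt0) /component_density.
set N := kneser_order v in N_gt xN N_gt0 *.
set K := kneser_degree v - theta v.
have K_ge0 : 0 <= K by apply: degree_sub_theta_ge0.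
(* The second summand is the value at [x = 2]. The first is nonnegative because
   [2 <= x <= N - v <= N - v / 4 - 1]. *)
have -> : N * (v / 4 * (x * tau v) - (x + (v / 4 - 1)) *
                 (tau v + (theta v + K / N * x))) =
          K * ((x - 2) * (N - v / 4 - 1 - x)) +
          (K * (2 * N - 2 - v / 2) - N * ((v / 4 - 1) * (tau v + theta v))).
  rewrite /K /kneser_degree /theta /tau.
  by field; rewrite lt0r_neq0.
apply: ltr_wpDl; first by rewrite !mulr_ge0 //; lra.
(* For [v >= 13] the factor of [N] is at least [v + 8], while [NE] bounds the subtracted term by
   [N * (v + 4)]. *)
have -> : K * (2 * N - 2 - v / 2) - N * ((v / 4 - 1) * (tau v + theta v)) =
          (v - 6) * (v - 7) / 24 *
          (N * (v * (v - 13) + (v + 8)) - (v - 1) * (v - 8) * (v + 4) / 2).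
  by rewrite /K degree_sub_thetaE /theta /tau; field.
apply: mulr_gt0.
  by rewrite !mulr_gt0 ?subr_gt0 ?invr_gt0 //; lra.
have NE : (v - 1) * (v - 8) / 2 <= N.
  rewrite -subr_ge0 /N /kneser_order.
  have -> : v * (v - 1) * (v - 2) * (v - 3) / 24 - (v - 1) * (v - 8) / 2 =
            (v - 1) / 24 * ((v - 13) * (v ^+ 2 + 8 * v + 98) + 1370).
    by field.
  apply: mulr_ge0; nra.
rewrite subr_gt0; apply: le_lt_trans (_ : N * (v + 4) < _).
  by rewrite mulrAC ler_wpM2r //; lra.
rewrite ltr_pM2l //; nra.
Qed.

End Weights.

(** * Transfer to the vertices of K(n,4), and counting *)

Section Kneser.

Variable n : nat.
Hypothesis n_ge13 : (13 <= n)%N.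
Local Notation vert := (kvert n 4).
Local Notation adj := (@kneser_adj n 4).
Local Notation v := (n%:R : rat).

Lemma kneser_adj_sym : symmetric adj.
Proof. by move=> A B; rewrite /kneser_adj disjoint_sym. Qed.

Lemma kneser_adjxx A : adj A A = false.
Proof.
rewrite /kneser_adj -setI_eq0 setIid -cards_eq0.
by have /eqP -> := valP A.
Qed.

Lemma card_kvert_sub (B : {set 'I_n}) :
  #|[set x : vert | val x \subset B]| = 'C(#|B|, 4).
Proof.
rewrite -cards_draws -(card_imset _ val_inj); apply: eq_card => A.
apply/imsetP/setIdP => [[x]|[AB A4]].
  by rewrite inE => xB ->; split=> //; apply: (valP x).
by exists (exist _ A A4 : vert); rewrite ?inE.
Qed.

(** Extension by the default value 0 to sets of size other than 4, so that the bounds for set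
    functions apply. *)
Definition extend (g : vert -> rat) : {ffun {set 'I_n} -> rat^o} :=
  [ffun A => oapp g 0 (insub A)].

Lemma extend_val g x : extend g (val x) = g x.
Proof. by rewrite ffunE valK. Qed.

Lemma extend_level g : level 4 (extend g).
Proof. by move=> A A4; rewrite ffunE insubN. Qed.

Lemma sum_kvert (F : {set 'I_n} -> rat) :
  (forall A : {set 'I_n}, #|A| != 4 -> F A = 0) ->
  \sum_A F A = \sum_(x : vert) F (val x).
Proof.
move=> F0; rewrite -(big_sub _ F) [RHS]big_mkcond; apply: eq_bigr => A _.
by case: ifPn => // /F0.
Qed.

Lemma extend_formE g :
  \sum_(A : {set 'I_n}) \sum_(B : {set 'I_n})
    extend g A * extend g B * [disjoint A & B]%:R =
  \sum_x \sum_y g x * g y * (adj x y)%:R.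
Proof.
rewrite sum_kvert => [|A A4]; last first.
  by rewrite big1 // => B _; rewrite (extend_level g A4) !mul0r.
apply: eq_bigr => x _; rewrite sum_kvert => [|B B4]; last first.
  by rewrite (extend_level g B4) mulr0 mul0r.
by apply: eq_bigr => y _; rewrite !extend_val.
Qed.

Lemma extend_dotE g : dot (extend g) (extend g) = \sum_x g x ^+ 2.
Proof.
rewrite /dot sum_kvert => [|A A4]; last by rewrite (extend_level g A4) mulr0.
by apply: eq_bigr => x _; rewrite extend_val.
Qed.

Lemma extend_sumE g : \sum_A extend g A = \sum_x g x.
Proof.
rewrite sum_kvert => [|A A4]; last exact: extend_level.
by apply: eq_bigr => x _; rewrite extend_val.
Qed.

Let v_ge9 : 9 <= v. Proof. by rewrite ler_nat (leq_trans _ n_ge13). Qed.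
Let cardI : #|'I_n|%:R = v. Proof. by rewrite card_ord. Qed.

Lemma kneser_form_ge g :
  tau v / star_size v * (\sum_x g x) ^+ 2 - tau v * \sum_x g x ^+ 2 <=
  \sum_x \sum_y g x * g y * (adj x y)%:R.
Proof.
have := disjoint_form_ge cardI v_ge9 (@extend_level g).
by rewrite extend_formE extend_dotE extend_sumE.
Qed.

Lemma kneser_form_le g :
  \sum_x \sum_y g x * g y * (adj x y)%:R <= theta v * \sum_x g x ^+ 2 +
    (kneser_degree v - theta v) / kneser_order v * (\sum_x g x) ^+ 2.
Proof.
have := disjoint_form_le cardI v_ge9 (@extend_level g).
by rewrite extend_formE extend_dotE extend_sumE.
Qed.

Lemma natr_bin4 m : 'C(m, 4)%:R = kneser_order (m%:R) :> rat.
Proof.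
have b1 k : 'C(k, 1)%:R = k%:R :> rat by rewrite bin1.
have b2 k : 'C(k, 2)%:R = k%:R * (k%:R - 1) / 2 :> rat.
  elim: k => [|k IHk]; first by rewrite bin0n /=; field.
  by rewrite binS natrD IHk b1 -natr1; field.
have b3 k : 'C(k, 3)%:R = k%:R * (k%:R - 1) * (k%:R - 2) / 6 :> rat.
  elim: k => [|k IHk]; first by rewrite bin0n /=; field.
  by rewrite binS natrD IHk b2 -natr1; field.
rewrite /kneser_order; elim: m => [|k IHk]; first by rewrite bin0n /=; field.
by rewrite binS natrD IHk b3 -natr1; field.
Qed.

Lemma card_kvert : #|vert|%:R = kneser_order v.
Proof.
have := card_kvert_sub setT; rewrite cardsT card_ord -natr_bin4 => <-.
by rewrite -cardsT; congr _%:R; apply: eq_card => x; rewrite !inE subsetT.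
Qed.

Lemma card_kneser_nbhd x : #|[set y | adj x y]|%:R = kneser_degree v.
Proof.
have -> : kneser_degree v = 'C(n - 4, 4)%:R.
  rewrite natr_bin4 natrB ?(leq_trans _ n_ge13) // /kneser_order.
  by rewrite /kneser_degree; field.
have -> : (n - 4)%N = #|~: val x|.
  have := cardsC (val x).
  by rewrite card_ord (eqP (valP x)) => /(canRL (addKn _)).
rewrite -card_kvert_sub; congr _%:R; apply: eq_card => y.
by rewrite !inE /kneser_adj disjoint_sym disjoints_subset.
Qed.

Lemma star_exists : exists2 I : {set vert},
  independent adj I & #|I|%:R = star_size v.
Proof.
(* The witness is the star of all 4-sets through a fixed point; it is counted through its complement
   [D], the 4-sets avoiding that point. *)
pose i0 := Ordinal (leq_trans (isT : 1 <= 13)%N n_ge13).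
exists [set x : vert | i0 \in val x].
  apply/'forall_in_'forall_in_idP => x; rewrite inE => xi y; rewrite inE => yi.
  by apply/pred0Pn; exists i0; rewrite /= xi.
have := card_kvert_sub (~: [set i0]); set D := [set x | _] => cD.
have cC := cardsC D.
have -> : [set x : vert | i0 \in val x] = ~: D.
  apply/setP=> x; rewrite !inE subsetC sub1set inE negbK.
  by [].
move: cC => /(congr1 (fun k => k%:R : rat)); rewrite natrD card_kvert cD.
rewrite natr_bin4 cardsC1 card_ord -subn1 natrB ?(leq_trans _ n_ge13) //.
rewrite /kneser_order => /(canRL (addKr _)) ->.
by rewrite /star_size; field.
Qed.

End Kneser.

(** * Vertex cuts of K(n,4) and the equality case *)

Section KneserCuts.

Variable n : nat.
Hypothesis n_ge13 : (13 <= n)%N.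
Local Notation vert := (kvert n 4).
Local Notation adj := (@kneser_adj n 4).
Local Notation v := (n%:R : rat).

Let v_ge13 : 13 <= v. Proof. by rewrite ler_nat. Qed.

(** Hoffman's ratio bound: the form vanishes on the indicator of [I]. This is Erdos-Ko-Rado for
    4-sets. *)
Lemma independent_card_le (I : {set vert}) :
  independent adj I -> #|I|%:R <= star_size v.
Proof.
move=> /'forall_in_'forall_in_idP indep; pose g x : rat := (x \in I)%:R.
have sumg k : (0 < k)%N -> \sum_x g x ^+ k = #|I|%:R.
  move=> k_gt0; rewrite -sum1_card natr_sum [RHS]big_mkcond.
  apply: eq_bigr => x _; rewrite /g.
  by case: (x \in I); rewrite ?expr1n // expr0n gtn_eqF.
have a_gt0 : 0 < star_size v by apply: lt_trans ltr01 (star_size_gt1 v_ge13).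
have := kneser_form_ge n_ge13 g; rewrite sumg // (sumg 1%N) //.
rewrite [X in _ <= X]big1 => [|x _]; last first.
  rewrite big1 // => y _; rewrite /g.
  have [xI|] := boolP (x \in I); last by rewrite !mul0r.
  have [yI|] := boolP (y \in I); last by rewrite mulr0 mul0r.
  by rewrite (negPf (indep x xI y yI)) mulr0.
rewrite subr_le0 -mulrA ler_pM2l ?tau_gt0 // mulrC ler_pdivrMr //.
have [I0|I_gt0] := posnP #|I|; first by move=> _; rewrite I0 ltW.
by rewrite expr2 ler_pM2l // ltr0n.
Qed.

(** A single vertex spans no edge; using the exact value 0 there gives it weight 1, which makes the
    final bound tight. *)
Definition density (C : {set vert}) : rat :=
  if #|C| == 1 then 0 else component_density v #|C|%:R.

(** For [#|C| != 1], apply the upper spectral bound to the indicator of [C]. *)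
Lemma edge_sum_le C : (edge_sum adj C)%:R <= density C * #|C|%:R.
Proof.
rewrite /density; have [/eqP /cards1P [x ->]|_] := eqVneq #|C| 1%N.
  by rewrite mul0r /edge_sum !big_set1 kneser_adjxx.
pose g x : rat := (x \in C)%:R.
have sumg k : (0 < k)%N -> \sum_x g x ^+ k = #|C|%:R.
  move=> k_gt0; rewrite -sum1_card natr_sum [RHS]big_mkcond.
  apply: eq_bigr => x _; rewrite /g.
  by case: (x \in C); rewrite ?expr1n // expr0n gtn_eqF.
have := kneser_form_le n_ge13 g; rewrite sumg // (sumg 1%N) //.
have -> : theta v * #|C|%:R + (kneser_degree v - theta v) / kneser_order v *
          #|C|%:R ^+ 2 = component_density v #|C|%:R * #|C|%:R.
  by rewrite /component_density; ring.
apply: le_trans; rewrite le_eqVlt; apply/orP; left; apply/eqP.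
rewrite natr_sum big_mkcond; apply: eq_bigr => x _.
rewrite {1}/g; case: (x \in C); last by rewrite big1 // => y _; rewrite !mul0r.
rewrite natr_sum big_mkcond; apply: eq_bigr => y _; rewrite mul1r /g.
by case: (y \in C); rewrite ?mul1r ?mul0r.
Qed.

Section Cut.

Variable S : {set vert}.
Hypothesis cutS : is_vertex_cut adj S.

(** A vertex [y] of another component and all neighbours of [y] lie outside [C], which excludes
    [1 + kneser_degree v >= v] vertices. *)
Lemma component_card_le C :
  C \in components adj S -> #|C|%:R <= kneser_order v - v.
Proof.
move=> CS; have [D DS DC] : exists2 D, D \in components adj S & D != C.
  have : (0 < #|components adj S :\ C|)%N.
    by move: cutS; rewrite /is_vertex_cut /ncomp (cardsD1 C) CS.
  by case/card_gt0P=> D; rewrite !inE => /andP [DC DS]; exists D.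
have /componentsP [y yS Dy] := DS; pose Ny := [set z | adj y z].
have CNy : C \subset ~: (y |: Ny).
  apply/subsetP=> z zC; have zS := components_notin CS zC.
  rewrite !inE; apply: contraNN DC => /orP [/eqP zy|yz].
    by rewrite Dy (components_eq (@kneser_adj_sym n) CS zC) zy.
  have := component_adj yS zS yz => /(component_eq (@kneser_adj_sym n)).
  by rewrite Dy -(components_eq (@kneser_adj_sym n) CS zC) => ->.
have := cardsC (y |: Ny).
rewrite cardsU1 inE kneser_adjxx /= => /(congr1 (fun k => k%:R : rat)).
rewrite !natrD card_kvert // card_kneser_nbhd // => NE.
have d_ge := kneser_degree_ge v_ge13.
have : #|C|%:R <= #|~: (y |: Ny)|%:R :> rat by rewrite ler_nat subset_leq_card.
lra.
Qed.

Let w (C : {set vert}) : rat := #|C|%:R * (tau v / (tau v + density C)).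

(** A singleton has [w C = 1] and both sides equal [v / 4]; larger components give a strict
    inequality. *)
Lemma weight_ge C : C \in components adj S ->
  #|C|%:R + (v / 4 - 1) <= v / 4 * w C ?= iff (#|C| == 1).
Proof.
move=> CS; apply/leifP; rewrite /w /density.
have [-> /=|C1] := eqVneq #|C| 1%N.
  have t_gt0 := tau_gt0 v_ge13.
  by rewrite addr0 (divff (lt0r_neq0 t_gt0)) !mulr1 addrC subrK.
apply: component_weight_gt => //; last exact: component_card_le.
rewrite ler_nat ltn_neqAle eq_sym C1 card_gt0; apply/set0Pn.
by have /componentsP [x _ ->] := CS; exists x; apply: component_refl.
Qed.

Lemma sum_weight_le : \sum_(C in components adj S) w C <= star_size v.
Proof.
have a_gt0 : 0 < star_size v by apply: lt_trans ltr01 (star_size_gt1 v_ge13).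
apply: (component_weight_bound (@kneser_adj_sym n) (tau_gt0 v_ge13) a_gt0).
  exact: kneser_form_ge.
move=> C _; split; last exact: edge_sum_le.
by rewrite /density; case: ifP => // _; apply: component_density_ge0.
Qed.

Lemma card_compl_cut :
  #|~: S|%:R = \sum_(C in components adj S) #|C|%:R :> rat.
Proof.
rewrite -sum1_card natr_sum (sum_components _ (@kneser_adj_sym n)).
by apply: eq_bigr => C _; rewrite -natr_sum sum1_card.
Qed.

(** Sum [weight_ge] over the components, bound the total by [v / 4 * star_size v = #|~: S| + #|S|],
    and cancel [#|~: S|]. The equality conditions of both steps are carried along. *)
Lemma cut_card_ge :
  (v / 4 - 1) * (ncomp adj S)%:R <= #|S|%:R ?= iff
  [forall C in components adj S, #|C| == 1] &&
  (\sum_(C in components adj S) w C == star_size v).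
Proof.
have v4_gt0 : 0 < v / 4 by rewrite divr_gt0 // (lt_le_trans _ v_ge13).
have le_order : \sum_(C in components adj S) v / 4 * w C <=
    #|~: S|%:R + #|S|%:R ?= iff
    (\sum_(C in components adj S) w C == star_size v).
  rewrite -mulr_sumr -natrD addnC cardsC card_kvert // kneser_orderE; split.
    by rewrite ler_pM2l // sum_weight_le.
  by rewrite (inj_eq (mulfI (lt0r_neq0 v4_gt0))).
have := leif_trans (leif_sum weight_ge) le_order.
rewrite big_split sumr_const -card_compl_cut /Order.leif lerD2l.
rewrite (inj_eq (addrI _)).
by rewrite (mulr_natr (v / 4 - 1)).
Qed.

Lemma cut_ratio_ge : v / 4 - 1 <= cut_ratio adj S.
Proof.
have c_gt0 : 0 < (ncomp adj S)%:R :> rat by rewrite ltr0n (leq_trans _ cutS).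
by rewrite /cut_ratio ler_pdivlMr // cut_card_ge.
Qed.

(** Equality makes all components singletons, so no edge survives outside [S]; every weight is then
    1 and the weights sum to [star_size v]. *)
Lemma cut_ratio_eq : cut_ratio adj S = v / 4 - 1 ->
  independent adj (~: S) /\ #|~: S|%:R = star_size v.
Proof.
have c_neq0 : (ncomp adj S)%:R != 0 :> rat.
  by rewrite pnatr_eq0 -lt0n (leq_trans _ cutS).
move=> ratio; have /eqP cardS : (v / 4 - 1) * (ncomp adj S)%:R == #|S|%:R.
  by rewrite -ratio /cut_ratio divfK.
move: cardS => /eqP; rewrite cut_card_ge => /andP [/forall_inP comp1 /eqP W].
split.
  apply/'forall_in_'forall_in_idP => x; rewrite in_setC => xS y.
  rewrite in_setC => yS; apply/negP => xy.
  have xC : component adj S x \in components adj S.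
    by apply/componentsP; exists x.
  have /cards1P [z Cz] := comp1 _ xC.
  have := component_refl adj S x; have := component_adj xS yS xy.
  by rewrite Cz !inE => /eqP yz /eqP xz; rewrite xz yz kneser_adjxx in xy.
rewrite card_compl_cut -W; apply: eq_bigr => C CS.
have := comp1 _ CS; rewrite /w /density => ->.
by rewrite addr0 divff ?mulr1 // gt_eqF // tau_gt0.
Qed.

End Cut.

(** Deleting everything but a star isolates its [a] vertices, and [(N - a) / a = v / 4 - 1] since
    [N = v / 4 * a]. *)
Lemma star_cut : exists2 S : {set vert},
  is_vertex_cut adj S & cut_ratio adj S = v / 4 - 1.
Proof.
have [I indep cardI] := star_exists n_ge13.
have a_gt1 := star_size_gt1 v_ge13.
exists (~: I); rewrite /is_vertex_cut /cut_ratio ncomp_independent //.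
  by rewrite -(ltr_nat rat) cardI.
have -> : #|~: I|%:R = kneser_order v - star_size v.
  by rewrite -card_kvert // -(cardsC I) natrD cardI addrAC subrr add0r.
rewrite cardI kneser_orderE mulrBl mulfK ?divff //;
  by rewrite gt_eqF // (lt_trans ltr01 a_gt1).
Qed.

End KneserCuts.

Local Close Scope ring_scope.

Theorem theorem5p1 (n : nat) : 13 <= n ->
  toughness (@kneser_adj n 4) = ((n%:R / 4%:R) - 1 : rat)%R /\
  (forall S : {set kvert n 4},
     is_vertex_cut (@kneser_adj n 4) S ->
     cut_ratio (@kneser_adj n 4) S = ((n%:R / 4%:R) - 1 : rat)%R ->
     exists I : {set kvert n 4},
       max_independent (@kneser_adj n 4) I /\ S = ~: I).
Proof.
move=> n_ge13; split=> [|S cutS /(cut_ratio_eq n_ge13 cutS) [indep cardI]].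
  have [S cutS ratioS] := star_cut n_ge13.
  have v13 : (13 <= n%:R :> rat)%R by rewrite ler_nat.
  apply/le_anti/andP; split.
    by rewrite -ratioS; apply: bigmin_le_cond.
  apply: le_bigmin => [|S' cutS']; last exact: cut_ratio_ge.
  (* The default value of the minimum, the number of vertices, must also be at least [n / 4 - 1]. *)
  rewrite card_kvert //; have := kneser_order_gt v13; lra.
exists (~: S); rewrite setCK; split=> //; apply/andP; split=> //.
apply/forallP=> J; apply/implyP=> indepJ.
by rewrite -(ler_nat rat) cardI independent_card_le.
Qed.
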